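(* Let $z_0\in\mathbb{D}$ be a fixed point. (a) If $p=1$, then $V_1(z_0)=\{1\}$. (b) If $p\ge2$, then $V_p(z_0)=\overline{\mathbb{D}}$.
   Context: $\mathbb{D}=\{z\in\mathbb{C}:|z|<1\}$ and $\overline{\mathbb{D}}$ is its closure. For an integer $p\ge1$, a $2p$-times continuously differentiable complex-valued function $f$ on $\mathbb{D}$ is $p$-harmonic if $\Delta^pf=0$, where $\Delta=4\frac{\partial^2}{\partial z\partial\overline z}$ and $\Delta^p$ is its $p$-fold iterate. $\mathcal{H}_p$ denotes the set of all $p$-harmonic mappings $f$ of $\mathbb{D}$ with the normalization $f_{z^{p-1}}(0)=(p-1)!$ and $|f(z)|\le1$ for $|z|<1$, where $f_{z^{p-1}}=\partial^{p-1}f/\partial z^{p-1}$ (so $f(0)=1$ when $p=1$). By convention $\mathcal{H}_0=\emptyset$. For $z_0\in\mathbb{D}$, $$V_p(z_0)=\{f(z_0):\ f\in\mathcal{H}_p\setminus\mathcal{H}_{p-1}\}.$$ *)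

(* Defs.v *)
From Stdlib Require Import Factorial Reals.
From Coquelicot Require Import Coquelicot.

Open Scope C_scope.

Definition unit_disk (z : C) : Prop := Cmod z < 1.

Definition closure (A : C -> Prop) (w : C) : Prop :=
  forall P : C -> Prop, locally w P -> exists z, A z /\ P z.

Definition re_part (f : C -> C) (x y : R) : R := Re (f (x, y)).
Definition im_part (f : C -> C) (x y : R) : R := Im (f (x, y)).

(* A function on an open set U is represented by a total function on C whose
   values outside U are irrelevant: continuity and all the derivatives below,
   taken at a point of U, only depend on the values near that point. *)
Definition class_C (n : nat) (U : C -> Prop) (f : C -> C) : Prop :=
  forall z, U z ->
    ex_diff_n (re_part f) n (Re z) (Im z) /\
    ex_diff_n (im_part f) n (Re z) (Im z).

Definition partial_x (f : C -> C) (z : C) : C :=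
  (Derive (fun t => re_part f t (Im z)) (Re z),
   Derive (fun t => im_part f t (Im z)) (Re z)).

Definition partial_y (f : C -> C) (z : C) : C :=
  (Derive (fun t => re_part f (Re z) t) (Im z),
   Derive (fun t => im_part f (Re z) t) (Im z)).

Definition d_z (f : C -> C) (z : C) : C :=
  (partial_x f z - Ci * partial_y f z) / 2.

Definition d_zbar (f : C -> C) (z : C) : C :=
  (partial_x f z + Ci * partial_y f z) / 2.

Definition laplacian (f : C -> C) (z : C) : C := 4 * d_z (d_zbar f) z.

Definition p_harmonic (p : nat) (f : C -> C) : Prop :=
  class_C (2 * p) unit_disk f /\
  forall z, unit_disk z -> Nat.iter p laplacian f z = 0.

Definition calH (p : nat) (f : C -> C) : Prop :=
  match p with
  | O => False
  | S q =>
      p_harmonic p f /\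
      Nat.iter q d_z f 0 = RtoC (INR (fact q)) /\
      forall z, unit_disk z -> Cmod (f z) <= 1
  end.

Definition V (p : nat) (z0 w : C) : Prop :=
  exists f : C -> C, calH p f /\ ~ calH (p - 1) f /\ f z0 = w.

(* Main.v *)
(** (a) If [u = Re f] attains its maximum 1 at the centre, its mean over every circle around 0
    is 1, so [u = 1], and [|f| <= 1] then forces [Im f = 0].
    (b) With [n = p - 1] and [c] unimodular, the function
    [f z = c * (1 - c * Cconj z ^ n) / (1 - Cconj c * z ^ n)] has modulus 1 everywhere, its
    [n]-th z-derivative at 0 is [n!], and it has degree [n] in [Cconj z], hence is [p]-harmonic.
    As [c] runs over the unit circle [f z0] covers the unit circle, and the remaining values are
    reached by convex combinations of two such functions. *)
Require Import Defs.
From Stdlib Require Import Factorial FunctionalExtensionality Reals Lra Lia.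
From Coquelicot Require Import Coquelicot.
Local Open Scope R_scope.

(** * The maximum principle at the centre *)

(** The set in (b) leaves out the class of index [p - 1 = n], so every function used, convex
    combinations included, must also be kept out of that class. This is why the expansion is
    followed up to the mixed term in [z ^ n * Cconj z ^ n]. For [n >= 2] the absence of a
    [z ^ (n - 1)] term contradicts the normalization of the smaller class. For [n = 1] that
    normalization is [f 0 = 1] and can hold, but only with constant term [c = 1]; then it is
    harmonicity that fails, because the mixed coefficient is [- c]. Recording this coefficient as
    tied to the constant term makes the argument survive convex combinations, where [c] need no
    longer be unimodular. In (a) the means over circles are constant because the flux of the
    gradient through a circle does not depend on the radius and is 0 at radius 0. *)

Definition disk2 (x y : R) : Prop := x * x + y * y < 1.

Definition gradient (f fx fy : R -> R -> R) : Prop :=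
  forall x y, disk2 x y -> differentiable_pt_lim f x y (fx x y) (fy x y).

Definition continuous_on_disk (f : R -> R -> R) : Prop :=
  forall x y, disk2 x y -> continuity_2d_pt f x y.

Lemma gradient_continuous (f fx fy : R -> R -> R) :
  gradient f fx fy -> continuous_on_disk f.
Proof.
  intros Hf x y Hxy. apply differentiable_continuity_pt.
  exists (fx x y), (fy x y). now apply Hf.
Qed.

(** The given point itself is rotated, instead of passing to polar coordinates: scale 1 and angle 0
    give back [(x0, y0)], and the origin needs no separate case. *)
Definition rot_x (x0 y0 th : R) : R := x0 * cos th - y0 * sin th.
Definition rot_y (x0 y0 th : R) : R := x0 * sin th + y0 * cos th.

Lemma rot_norm (x0 y0 th : R) :
  rot_x x0 y0 th * rot_x x0 y0 th + rot_y x0 y0 th * rot_y x0 y0 th = x0 * x0 + y0 * y0.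
Proof.
  unfold rot_x, rot_y. pose proof (sin2_cos2 th) as H. unfold Rsqr in H.
  replace (x0 * x0 + y0 * y0) with ((x0 * x0 + y0 * y0) * (sin th * sin th + cos th * cos th))
    by (rewrite H; ring).
  ring.
Qed.

Lemma rot_disk (x0 y0 t th : R) :
  t * t * (x0 * x0 + y0 * y0) < 1 -> disk2 (t * rot_x x0 y0 th) (t * rot_y x0 y0 th).
Proof.
  intros H. unfold disk2. rewrite <- (rot_norm x0 y0 th) in H. lra.
Qed.

Lemma is_derive_rot_x (x0 y0 th : R) : is_derive (rot_x x0 y0) th (- rot_y x0 y0 th).
Proof.
  unfold rot_x, rot_y. auto_derive; [trivial | ring].
Qed.

Lemma is_derive_rot_y (x0 y0 th : R) : is_derive (rot_y x0 y0) th (rot_x x0 y0 th).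
Proof.
  unfold rot_x, rot_y. auto_derive; [trivial | ring].
Qed.

Lemma is_derive_radial (f fx fy : R -> R -> R) (x0 y0 t th : R) :
  gradient f fx fy -> t * t * (x0 * x0 + y0 * y0) < 1 ->
  is_derive (fun u => f (u * rot_x x0 y0 th) (u * rot_y x0 y0 th)) t
    (fx (t * rot_x x0 y0 th) (t * rot_y x0 y0 th) * rot_x x0 y0 th +
     fy (t * rot_x x0 y0 th) (t * rot_y x0 y0 th) * rot_y x0 y0 th).
Proof.
  intros Hf Ht. apply is_derive_Reals.
  apply (derivable_pt_lim_comp_2d f (fun u => u * rot_x x0 y0 th) (fun u => u * rot_y x0 y0 th)).
  - apply Hf. now apply rot_disk.
  - apply is_derive_Reals. auto_derive; [trivial | ring].
  - apply is_derive_Reals. auto_derive; [trivial | ring].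
Qed.

Lemma is_derive_angular (f fx fy : R -> R -> R) (x0 y0 t th : R) :
  gradient f fx fy -> t * t * (x0 * x0 + y0 * y0) < 1 ->
  is_derive (fun u => f (t * rot_x x0 y0 u) (t * rot_y x0 y0 u)) th
    (fx (t * rot_x x0 y0 th) (t * rot_y x0 y0 th) * (- (t * rot_y x0 y0 th)) +
     fy (t * rot_x x0 y0 th) (t * rot_y x0 y0 th) * (t * rot_x x0 y0 th)).
Proof.
  intros Hf Ht. apply is_derive_Reals.
  apply (derivable_pt_lim_comp_2d f (fun u => t * rot_x x0 y0 u) (fun u => t * rot_y x0 y0 u)).
  - apply Hf. now apply rot_disk.
  - apply is_derive_Reals. replace (- (t * rot_y x0 y0 th)) with (t * - rot_y x0 y0 th) by ring.
    apply is_derive_scal, is_derive_rot_x.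
  - apply is_derive_Reals. apply is_derive_scal, is_derive_rot_y.
Qed.

Lemma continuous_rot_x (x0 y0 th : R) : continuous (rot_x x0 y0) th.
Proof.
  apply (ex_derive_continuous (K := R_AbsRing) (V := R_NormedModule)). eexists. apply is_derive_rot_x.
Qed.

Lemma continuous_rot_y (x0 y0 th : R) : continuous (rot_y x0 y0) th.
Proof.
  apply (ex_derive_continuous (K := R_AbsRing) (V := R_NormedModule)). eexists. apply is_derive_rot_y.
Qed.

(** * Joint continuity and integrals depending on a parameter *)

Lemma continuity_2d_pt_iff_continuous (f : R -> R -> R) (x y : R) :
  continuity_2d_pt f x y <-> continuous (fun p : R * R => f (fst p) (snd p)) (x, y).
Proof.
  apply continuity_2d_pt_filterlim.
Qed.

Lemma continuity_2d_pt_comp_2 (f g h : R -> R -> R) (x y : R) :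
  continuity_2d_pt f (g x y) (h x y) -> continuity_2d_pt g x y -> continuity_2d_pt h x y ->
  continuity_2d_pt (fun u v => f (g u v) (h u v)) x y.
Proof.
  rewrite !continuity_2d_pt_iff_continuous. intros Hf Hg Hh.
  exact (continuous_comp_2 (fun p : R * R => g (fst p) (snd p))
    (fun p : R * R => h (fst p) (snd p)) f (x, y) Hg Hh Hf).
Qed.

Lemma continuity_2d_pt_snd (f : R -> R) (x y : R) :
  continuous f y -> continuity_2d_pt (fun _ v => f v) x y.
Proof.
  intros Hf. apply continuity_2d_pt_iff_continuous.
  apply (continuous_comp (fun p : R * R => snd p) f); [apply continuous_snd | exact Hf].
Qed.

Lemma continuity_2d_pt_slice (f : R -> R -> R) (x y : R) :
  continuity_2d_pt f x y -> continuous (fun v => f x v) y.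
Proof.
  rewrite continuity_2d_pt_iff_continuous. intros Hf.
  apply (continuous_comp_2 (fun _ : R => x) (fun v : R => v) f); trivial.
  - apply continuous_const.
  - apply continuous_id.
Qed.

Lemma continuity_2d_pt_polar (f : R -> R -> R) (x0 y0 t th : R) :
  continuous_on_disk f -> t * t * (x0 * x0 + y0 * y0) < 1 ->
  continuity_2d_pt (fun u v => f (u * rot_x x0 y0 v) (u * rot_y x0 y0 v)) t th.
Proof.
  intros Hf Ht.
  apply (continuity_2d_pt_comp_2 f (fun u v => u * rot_x x0 y0 v) (fun u v => u * rot_y x0 y0 v)).
  - apply Hf. now apply rot_disk.
  - apply continuity_2d_pt_mult; [apply continuity_2d_pt_id1 |].
    apply continuity_2d_pt_snd, continuous_rot_x.
  - apply continuity_2d_pt_mult; [apply continuity_2d_pt_id1 |].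
    apply continuity_2d_pt_snd, continuous_rot_y.
Qed.

Lemma locally_radius (rho t : R) :
  t * t * rho < 1 -> locally t (fun u => u * u * rho < 1).
Proof.
  intros Ht.
  assert (Hc : continuous (fun u => u * u * rho) t).
  { apply (ex_derive_continuous (K := R_AbsRing) (V := R_NormedModule)). auto_derive. trivial. }
  exact (Hc (fun y => y < 1) (open_lt 1 (t * t * rho) Ht)).
Qed.

(** Differentiation under the integral sign with an explicit derivative in place of [Derive]. The
    hypotheses range over all [th], since the polar integrands are controlled at every angle. *)
Lemma is_derive_RInt_param_cont (F dF : R -> R -> R) (a b t : R) :
  locally t (fun u => forall th, is_derive (fun s => F s th) u (dF u th)) ->
  locally t (fun u => forall th, continuity_2d_pt F u th) ->
  (forall th, continuity_2d_pt dF t th) ->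
  is_derive (fun u => RInt (F u) a b) t (RInt (dF t) a b).
Proof.
  intros HF HcF HcdF.
  assert (HD : locally t (fun u => forall th, Derive (fun s => F s th) u = dF u th)).
  { revert HF. apply filter_imp. intros u Hu th. apply is_derive_unique, Hu. }
  rewrite (RInt_ext (dF t) (fun th => Derive (fun s => F s th) t)).
  2:{ intros th _. symmetry. now apply (locally_singleton _ _ HD). }
  apply is_derive_RInt_param.
  - revert HF. apply filter_imp. intros u Hu th _. exists (dF u th). apply Hu.
  - intros th _. apply (continuity_2d_pt_ext_loc dF); [| apply HcdF].
    destruct HD as [d Hd]. exists d. intros u v Hu _. symmetry. now apply Hd.
  - revert HcF. apply filter_imp. intros u Hu. apply (ex_RInt_continuous (V := R_CompleteNormedModule)).
    intros th _. now apply continuity_2d_pt_slice, Hu.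
Qed.

(** The integrals over [[a, x]] and [[x, b]] are nonnegative with sum 0, so the primitive vanishes
    on the whole open interval and its derivative at the interior point [c] is 0. *)
Lemma RInt_zero_continuous (f : R -> R) (a b c : R) :
  a < c < b -> (forall x, continuous f x) -> (forall x, 0 <= f x) ->
  RInt f a b = 0 -> f c = 0.
Proof.
  intros Hc Hf Hpos Hint.
  assert (Hex : forall u v, ex_RInt f u v).
  { intros u v. apply (ex_RInt_continuous (V := R_CompleteNormedModule)). intros; apply Hf. }
  assert (H0 : forall x, a < x < b -> RInt f a x = 0).
  { intros x Hx.
    pose proof (RInt_Chasles f a x b (Hex a x) (Hex x b)) as HC. rewrite Hint in HC.
    pose proof (RInt_ge_0 f a x ltac:(lra) (Hex a x) ltac:(intros; apply Hpos)).
    pose proof (RInt_ge_0 f x b ltac:(lra) (Hex x b) ltac:(intros; apply Hpos)).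
    unfold plus in HC; simpl in HC. lra. }
  assert (HD : is_derive (fun x => RInt f a x) c (f c)).
  { apply (is_derive_RInt f (fun x => RInt f a x) a c); [| apply Hf].
    apply filter_forall. intros x. apply (RInt_correct (V := R_CompleteNormedModule)), Hex. }
  assert (HD0 : is_derive (fun x => RInt f a x) c 0).
  { apply (is_derive_ext_loc (fun _ => 0)); [| apply (is_derive_const (K := R_AbsRing) (V := R_NormedModule))].
    apply (filter_imp (fun x => a < x /\ x < b)).
    - intros x Hx. symmetry. now apply H0.
    - apply filter_and; [now apply open_gt | now apply open_lt]. }
  apply is_derive_unique in HD. apply is_derive_unique in HD0. lra.
Qed.

(* With P and T the radial and angular derivatives of v, harmonicity reads
   d(tP)/dt = - dT/dth, so the integral of tP over a circle does not depend on t. *)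
Lemma harmonic_max_center (v vx vy vxx vxy vyy : R -> R -> R) (x0 y0 : R) :
  gradient v vx vy -> gradient vx vxx vxy -> gradient vy vxy vyy ->
  continuous_on_disk vxx -> continuous_on_disk vxy -> continuous_on_disk vyy ->
  (forall x y, disk2 x y -> vxx x y + vyy x y = 0) ->
  (forall x y, disk2 x y -> v x y <= v 0 0) ->
  disk2 x0 y0 -> v x0 y0 = v 0 0.
Proof.
  intros Hv Hvx Hvy Cxx Cxy Cyy Hharm Hmax H0.
  set (rho := x0 * x0 + y0 * y0).
  assert (Hrho : rho < 1) by exact H0.
  assert (Hrho0 : 0 <= rho) by (unfold rho; nra).
  set (X := rot_x x0 y0). set (Y := rot_y x0 y0).
  set (P := fun t th => vx (t * X th) (t * Y th) * X th + vy (t * X th) (t * Y th) * Y th).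
  set (T := fun t th => vx (t * X th) (t * Y th) * - Y th + vy (t * X th) (t * Y th) * X th).
  (* The derivative of [t * P t th] in [t]: the second term is [t] times the Hessian of [v]
     evaluated twice on the direction [(X th, Y th)]. *)
  set (Q := fun t th =>
     P t th + t * ((vxx (t * X th) (t * Y th) * X th + vxy (t * X th) (t * Y th) * Y th) * X th +
                   (vxy (t * X th) (t * Y th) * X th + vyy (t * X th) (t * Y th) * Y th) * Y th)).
  pose proof (gradient_continuous _ _ _ Hv) as Cv.
  pose proof (gradient_continuous _ _ _ Hvx) as Cvx.
  pose proof (gradient_continuous _ _ _ Hvy) as Cvy.
  assert (CX : forall t th, continuity_2d_pt (fun _ u => X u) t th).
  { intros. apply continuity_2d_pt_snd, continuous_rot_x. }
  assert (CY : forall t th, continuity_2d_pt (fun _ u => Y u) t th).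
  { intros. apply continuity_2d_pt_snd, continuous_rot_y. }
  assert (CP : forall t th, t * t * rho < 1 -> continuity_2d_pt P t th).
  { intros t th Ht. unfold P.
    apply continuity_2d_pt_plus; apply continuity_2d_pt_mult; trivial;
      now apply continuity_2d_pt_polar. }
  assert (CQ : forall t th, t * t * rho < 1 -> continuity_2d_pt Q t th).
  { intros t th Ht. unfold Q.
    apply continuity_2d_pt_plus; [now apply CP |].
    apply continuity_2d_pt_mult; [apply continuity_2d_pt_id1 |].
    apply continuity_2d_pt_plus; (apply continuity_2d_pt_mult; trivial);
      apply continuity_2d_pt_plus; (apply continuity_2d_pt_mult; trivial);
      now apply continuity_2d_pt_polar. }
  assert (DtP : forall t th, t * t * rho < 1 -> is_derive (fun s => s * P s th) t (Q t th)).
  { intros t th Ht.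
    pose proof (is_derive_radial vx vxx vxy x0 y0 t th Hvx Ht) as D1.
    pose proof (is_derive_radial vy vxy vyy x0 y0 t th Hvy Ht) as D2.
    fold X Y in D1, D2.
    assert (DP : is_derive (fun s => P s th) t
       ((vxx (t * X th) (t * Y th) * X th + vxy (t * X th) (t * Y th) * Y th) * X th +
        (vxy (t * X th) (t * Y th) * X th + vyy (t * X th) (t * Y th) * Y th) * Y th)).
    { unfold P. apply (is_derive_plus (K := R_AbsRing) (V := R_NormedModule)).
      - apply (is_derive_ext (fun s => X th * vx (s * X th) (s * Y th))).
        { intros s. apply Rmult_comm. }
        rewrite (Rmult_comm _ (X th)). now apply is_derive_scal.
      - apply (is_derive_ext (fun s => Y th * vy (s * X th) (s * Y th))).
        { intros s. apply Rmult_comm. }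
        rewrite (Rmult_comm _ (Y th)). now apply is_derive_scal. }
    pose proof (is_derive_mult (K := R_AbsRing) (fun s => s) (fun s => P s th) t 1 _
      (is_derive_id (K := R_AbsRing) t) DP Rmult_comm) as DD.
    eapply eq_rect; [exact DD |]. unfold Q, plus, mult; simpl. ring. }
  assert (DT : forall t th, t * t * rho < 1 -> is_derive (T t) th (- Q t th)).
  { intros t th Ht.
    pose proof (is_derive_angular vx vxx vxy x0 y0 t th Hvx Ht) as D1.
    pose proof (is_derive_angular vy vxy vyy x0 y0 t th Hvy Ht) as D2.
    fold X Y in D1, D2.
    assert (DY : is_derive (fun u => - Y u) th (- X th)).
    { apply (is_derive_opp (K := R_AbsRing) (V := R_NormedModule)), is_derive_rot_y. }
    assert (DX : is_derive X th (- Y th)) by apply is_derive_rot_x.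
    pose proof (is_derive_plus (K := R_AbsRing) (V := R_NormedModule) _ _ _ _ _
      (is_derive_mult (K := R_AbsRing) _ _ _ _ _ D1 DY Rmult_comm)
      (is_derive_mult (K := R_AbsRing) _ _ _ _ _ D2 DX Rmult_comm)) as DD.
    eapply eq_rect; [exact DD |]. unfold Q, P, plus, mult; simpl.
    pose proof (Hharm _ _ (rot_disk x0 y0 t th Ht)) as Hh. fold X Y in Hh.
    (* Harmonicity enters here: the angular derivative involves the Hessian on the perpendicular
       direction, and trace zero makes it the opposite of the radial one. *)
    replace (vyy (t * X th) (t * Y th)) with (- vxx (t * X th) (t * Y th)) by lra.
    ring. }
  (* The flux of the gradient through the circle. Its derivative is the integral of [- dT/dth] over
     a full period, which is 0 because [T] is periodic. *)
  set (N := fun t => RInt (fun th => t * P t th) (- PI) PI).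
  assert (DN : forall t, t * t * rho < 1 -> is_derive N t 0).
  { intros t Ht.
    replace 0 with (RInt (Q t) (- PI) PI).
    - apply (is_derive_RInt_param_cont (fun s th => s * P s th) Q).
      + apply (filter_imp (fun u => u * u * rho < 1)); [| now apply locally_radius].
        intros u Hu th. now apply DtP.
      + apply (filter_imp (fun u => u * u * rho < 1)); [| now apply locally_radius].
        intros u Hu th. apply continuity_2d_pt_mult; [apply continuity_2d_pt_id1 | now apply CP].
      + intros th. now apply CQ.
    - assert (HI : is_RInt (Q t) (- PI) PI (minus (- T t PI) (- T t (- PI)))).
      { apply (is_RInt_derive (V := R_CompleteNormedModule) (fun th => - T t th)).
        - intros th _. rewrite <- (Ropp_involutive (Q t th)).
          apply (is_derive_opp (K := R_AbsRing) (V := R_NormedModule)). now apply DT.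
        - intros th _. apply continuity_2d_pt_slice. now apply CQ. }
      rewrite (is_RInt_unique _ _ _ _ HI). unfold minus, plus, opp, T; simpl.
      assert (EX : X (- PI) = X PI).
      { unfold X, rot_x. rewrite cos_neg, sin_neg, sin_PI. ring. }
      assert (EY : Y (- PI) = Y PI).
      { unfold Y, rot_y. rewrite cos_neg, sin_neg, sin_PI. ring. }
      rewrite EX, EY. ring. }
  assert (Hrange : forall t, 0 <= t <= 1 -> t * t * rho < 1).
  { intros t Ht. assert (t * t <= 1) by nra. nra. }
  assert (N0 : N 0 = 0).
  { unfold N. rewrite (RInt_ext _ (fun _ => 0)) by (intros; apply Rmult_0_l).
    rewrite RInt_const. unfold scal; simpl. unfold mult; simpl. ring. }
  assert (HN : forall t, 0 < t <= 1 -> N t = 0).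
  { intros t Ht.
    destruct (MVT_cor2 N (fun _ => 0) 0 t ltac:(lra)) as [c [Hc _]].
    - intros c Hc. apply is_derive_Reals, DN, Hrange. lra.
    - lra. }
  set (M := fun t => RInt (fun th => v (t * X th) (t * Y th)) (- PI) PI).
  assert (DM : forall t, t * t * rho < 1 -> is_derive M t (RInt (P t) (- PI) PI)).
  { intros t Ht.
    apply (is_derive_RInt_param_cont (fun s th => v (s * X th) (s * Y th)) P).
    - apply (filter_imp (fun u => u * u * rho < 1)); [| now apply locally_radius].
      intros u Hu th. now apply is_derive_radial.
    - apply (filter_imp (fun u => u * u * rho < 1)); [| now apply locally_radius].
      intros u Hu th. now apply continuity_2d_pt_polar.
    - intros th. now apply CP. }
  assert (HM : M 1 - M 0 = 0).
  { destruct (MVT_cor2 M (fun t => RInt (P t) (- PI) PI) 0 1 ltac:(lra)) as [c [Hc Hc']].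
    - intros c Hc. apply is_derive_Reals, DM, Hrange. lra.
    - rewrite Hc. pose proof (HN c ltac:(lra)) as HNc. unfold N in HNc.
      assert (Hex : ex_RInt (P c) (- PI) PI).
      { apply (ex_RInt_continuous (V := R_CompleteNormedModule)).
        intros th _. apply continuity_2d_pt_slice, CP, Hrange. lra. }
      assert (E : RInt (fun th => c * P c th) (- PI) PI = c * RInt (P c) (- PI) PI).
      { exact (RInt_scal (V := R_CompleteNormedModule) (P c) (- PI) PI c Hex). }
      (* The mean value point lies strictly between 0 and 1, so the factor [c] can be cancelled. *)
      rewrite E in HNc. apply Rmult_integral in HNc. destruct HNc as [HNc | HNc]; [lra |].
      rewrite HNc. ring. }
  assert (HM0 : M 0 = RInt (fun _ => v 0 0) (- PI) PI).
  { apply RInt_ext. intros th _. now rewrite !Rmult_0_l. }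
  assert (Hcont : forall th, continuous (fun th => v (1 * X th) (1 * Y th)) th).
  { intros th. apply (continuity_2d_pt_slice (fun t u => v (t * X u) (t * Y u))).
    apply continuity_2d_pt_polar; [exact Cv | apply Hrange; lra]. }
  (* Integrating from [- PI] to [PI] makes the angle 0, which corresponds to [(x0, y0)], an interior
     point. *)
  pose proof (RInt_zero_continuous (fun th => v 0 0 - v (1 * X th) (1 * Y th)) (- PI) PI 0) as HZ.
  assert (EX : X 0 = x0) by (unfold X, rot_x; rewrite cos_0, sin_0; ring).
  assert (EY : Y 0 = y0) by (unfold Y, rot_y; rewrite cos_0, sin_0; ring).
  cbv beta in HZ. rewrite EX, EY, !Rmult_1_l in HZ.
  enough (v 0 0 - v x0 y0 = 0) by lra.
  apply HZ.
  - pose proof PI_RGT_0. lra.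
  - intros th. apply (continuous_minus (V := R_NormedModule)); [apply continuous_const | apply Hcont].
  - intros th.
    pose proof (Hmax _ _ (rot_disk x0 y0 1 th (Hrange 1 ltac:(lra)))) as Hle.
    fold X Y in Hle. lra.
  - pose proof (RInt_minus (V := R_CompleteNormedModule) (fun _ => v 0 0)
      (fun th => v (1 * X th) (1 * Y th)) (- PI) PI) as HI.
    unfold minus, plus, opp in HI; simpl in HI. unfold Rminus. rewrite HI.
    + rewrite <- HM0. fold (M 1). lra.
    + apply ex_RInt_const.
    + apply (ex_RInt_continuous (V := R_CompleteNormedModule)). intros; apply Hcont.
Qed.

(** * Second-order regularity and the real part of the Laplacian *)

Definition Dx (f : R -> R -> R) (x y : R) : R := Derive (fun t => f t y) x.
Definition Dy (f : R -> R -> R) (x y : R) : R := Derive (fun t => f x t) y.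

Lemma continuity_2d_pt_norm2 (x y : R) : continuity_2d_pt (fun u v => u * u + v * v) x y.
Proof.
  apply continuity_2d_pt_plus; apply continuity_2d_pt_mult;
    solve [apply continuity_2d_pt_id1 | apply continuity_2d_pt_id2].
Qed.

Lemma disk2_locally (x y : R) : disk2 x y -> locally_2d disk2 x y.
Proof.
  unfold disk2 at 1. intros H.
  destruct (continuity_2d_pt_norm2 x y (mkposreal (1 - (x * x + y * y)) ltac:(lra))) as [d Hd].
  exists d. intros u v Hu Hv. specialize (Hd u v Hu Hv). simpl in Hd.
  apply Rabs_lt_between in Hd. unfold disk2. lra.
Qed.

(** The x-derivative exists nearby and is continuous at the point, and the y-derivative exists at
    the point: this already yields the differential. *)
Lemma C1_gradient (f : R -> R -> R) :
  (forall x y, disk2 x y -> ex_diff_n f 1 x y) -> gradient f (Dx f) (Dy f).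
Proof.
  intros Hf x y Hxy. apply filterdiff_differentiable_pt_lim.
  destruct (Hf x y Hxy) as [_ [_ [H2 [H3 _]]]].
  apply (is_derive_filterdiff f x y (Dx f) (Dy f x y)).
  - destruct (disk2_locally x y Hxy) as [d Hd]. exists d. intros [u v] [Hu Hv].
    apply Derive_correct. exact (proj1 (proj2 (Hf u v (Hd u v Hu Hv)))).
  - now apply Derive_correct.
  - apply continuity_2d_pt_iff_continuous. exact (proj1 H3).
Qed.

Lemma Schwarz_disk (f : R -> R -> R) (x y : R) :
  (forall x y, disk2 x y -> ex_diff_n f 2 x y) -> disk2 x y -> Dx (Dy f) x y = Dy (Dx f) x y.
Proof.
  intros Hf Hxy. apply (Schwarz f x y).
  - destruct (disk2_locally x y Hxy) as [d Hd]. exists d. intros u v Hu Hv.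
    destruct (Hf u v (Hd u v Hu Hv)) as [_ [H1 [H2 [[_ [H3 [H4 H5]]] [_ [H6 [H7 H8]]]]]]].
    repeat split; assumption.
  - destruct (Hf x y Hxy) as [_ [_ [_ [_ [_ [_ [_ [H _]]]]]]]]. exact (proj1 H).
  - destruct (Hf x y Hxy) as [_ [_ [_ [[_ [_ [_ [_ H]]]] _]]]]. exact (proj1 H).
Qed.

Lemma disk2_unit_disk (x y : R) : disk2 x y <-> unit_disk (x, y).
Proof.
  unfold disk2, unit_disk, Cmod. cbn [fst snd].
  replace (x ^ 2 + y ^ 2) with (x * x + y * y) by ring.
  set (q := x * x + y * y). assert (Hq : 0 <= q) by (unfold q; nra). split; intros H.
  - rewrite <- sqrt_1. now apply sqrt_lt_1_alt.
  - apply sqrt_lt_0_alt. now rewrite sqrt_1.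
Qed.

Lemma re_part_d_zbar (f : C -> C) (x y : R) :
  re_part (d_zbar f) x y = (Dx (re_part f) x y - Dy (im_part f) x y) * / 2.
Proof. unfold re_part, d_zbar, partial_x, partial_y, Dx, Dy, re_part, im_part; simpl. field. Qed.

Lemma im_part_d_zbar (f : C -> C) (x y : R) :
  im_part (d_zbar f) x y = (Dx (im_part f) x y + Dy (re_part f) x y) * / 2.
Proof. unfold im_part, d_zbar, partial_x, partial_y, Dx, Dy, re_part, im_part; simpl. field. Qed.

(** The mixed derivatives of [im_part f] enter with opposite signs and cancel by Schwarz's
    theorem. *)
Lemma Re_laplacian (f : C -> C) (x y : R) :
  class_C 2 unit_disk f -> disk2 x y ->
  Re (laplacian f (x, y)) = Dx (Dx (re_part f)) x y + Dy (Dy (re_part f)) x y.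
Proof.
  intros Hf Hxy.
  assert (Hu : forall x y, disk2 x y -> ex_diff_n (re_part f) 2 x y).
  { intros a b Hab. exact (proj1 (Hf (a, b) (proj1 (disk2_unit_disk a b) Hab))). }
  assert (Hv : forall x y, disk2 x y -> ex_diff_n (im_part f) 2 x y).
  { intros a b Hab. exact (proj2 (Hf (a, b) (proj1 (disk2_unit_disk a b) Hab))). }
  assert (E : Re (laplacian f (x, y)) =
    2 * (Dx (re_part (d_zbar f)) x y + Dy (im_part (d_zbar f)) x y)).
  { unfold laplacian. generalize (d_zbar f). intros g.
    unfold d_z, partial_x, partial_y, Dx, Dy; simpl. field. }
  assert (E1 : Dx (re_part (d_zbar f)) x y =
    Derive (fun t => (Dx (re_part f) t y - Dy (im_part f) t y) * / 2) x).
  { apply Derive_ext. intros t. apply re_part_d_zbar. }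
  assert (E2 : Dy (im_part (d_zbar f)) x y =
    Derive (fun t => (Dx (im_part f) x t + Dy (re_part f) x t) * / 2) y).
  { apply Derive_ext. intros t. apply im_part_d_zbar. }
  rewrite E, E1, E2.
  destruct (Hu x y Hxy) as [_ [_ [_ [[_ [Hu1 _]] [_ [_ [Hu2 _]]]]]]].
  destruct (Hv x y Hxy) as [_ [_ [_ [[_ [_ [Hv1 _]]] [_ [Hv2 _]]]]]].
  rewrite !Derive_scal_l, Derive_minus, Derive_plus by assumption.
  pose proof (Schwarz_disk (im_part f) x y Hv Hxy) as HS. unfold Dx, Dy in *. lra.
Qed.

Lemma harmonic_bounded_center (f : C -> C) (z : C) :
  p_harmonic 1 f -> f 0%C = RtoC 1 -> (forall z, unit_disk z -> Cmod (f z) <= 1) ->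
  unit_disk z -> f z = RtoC 1.
Proof.
  intros [Hc Hh] H0 Hb Hz. destruct z as [x y].
  simpl in Hc, Hh.
  assert (Hu : forall x y, disk2 x y -> ex_diff_n (re_part f) 2 x y).
  { intros a b Hab. exact (proj1 (Hc (a, b) (proj1 (disk2_unit_disk a b) Hab))). }
  assert (Hu1 : gradient (re_part f) (Dx (re_part f)) (Dy (re_part f))).
  { apply C1_gradient. intros a b Hab. apply (ex_diff_n_m 2); [lia | now apply Hu]. }
  assert (Hux : gradient (Dx (re_part f)) (Dx (Dx (re_part f))) (Dy (Dx (re_part f)))).
  { apply C1_gradient. intros a b Hab. apply ex_diff_n_deriv_aux1. now apply Hu. }
  assert (Huy : gradient (Dy (re_part f)) (Dx (Dy (re_part f))) (Dy (Dy (re_part f)))).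
  { apply C1_gradient. intros a b Hab. apply ex_diff_n_deriv_aux2. now apply Hu. }
  assert (Hxy : disk2 x y) by now apply disk2_unit_disk.
  assert (E0 : re_part f 0 0 = 1).
  { unfold re_part. change ((0, 0)) with (RtoC 0). now rewrite H0. }
  assert (E : re_part f x y = re_part f 0 0).
  { apply (harmonic_max_center _ _ _ (Dx (Dx (re_part f))) (Dy (Dx (re_part f)))
      (Dy (Dy (re_part f))) x y Hu1 Hux); trivial.
    (* The maximum principle takes one function for both mixed derivatives; Schwarz's theorem
       identifies them. *)
    - intros a b Hab. rewrite <- (Schwarz_disk _ a b Hu Hab). now apply Huy.
    - intros a b Hab. destruct (Hu a b Hab) as [_ [_ [_ [[_ [_ [_ [H _]]]] _]]]]. exact (proj1 H).
    - intros a b Hab. destruct (Hu a b Hab) as [_ [_ [_ [[_ [_ [_ [_ H]]]] _]]]]. exact (proj1 H).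
    - intros a b Hab. destruct (Hu a b Hab) as [_ [_ [_ [_ [_ [_ [_ [_ H]]]]]]]]. exact (proj1 H).
    - intros a b Hab. rewrite <- (Re_laplacian f a b Hc Hab).
      now rewrite (Hh (a, b) (proj1 (disk2_unit_disk a b) Hab)).
    - intros a b Hab. rewrite E0.
      pose proof (Hb (a, b) (proj1 (disk2_unit_disk a b) Hab)) as H1.
      pose proof (Rmax_Cmod (f (a, b))) as H2.
      pose proof (Rmax_l (Rabs (fst (f (a, b)))) (Rabs (snd (f (a, b))))) as H3.
      pose proof (Rle_abs (fst (f (a, b)))) as H4. unfold re_part, Re. lra. }
  rewrite E0 in E. specialize (Hb (x, y) Hz).
  unfold re_part in E. destruct (f (x, y)) as [a b]. simpl in E. subst a.
  unfold Cmod in Hb. cbn [fst snd] in Hb. rewrite <- sqrt_1 in Hb at 2.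
  apply sqrt_le_0 in Hb; [| nra | lra].
  unfold RtoC. f_equal. nra.
Qed.

(** * Wirtinger calculus for rational functions *)

(** Componentwise, to match the [Derive] of real and imaginary parts in [partial_x] and
    [partial_y]. *)
Definition curve_derive (c : R -> C) (t : R) (l : C) : Prop :=
  is_derive (fun s => Re (c s)) t (Re l) /\ is_derive (fun s => Im (c s)) t (Im l).

Lemma curve_derive_eq (c : R -> C) (t : R) (l m : C) :
  curve_derive c t l -> l = m -> curve_derive c t m.
Proof. now intros H <-. Qed.

Lemma curve_derive_const (a : C) (t : R) : curve_derive (fun _ => a) t 0%C.
Proof. split; apply (is_derive_const (K := R_AbsRing) (V := R_NormedModule)). Qed.

Lemma curve_derive_plus (c d : R -> C) (t : R) (l m : C) :
  curve_derive c t l -> curve_derive d t m -> curve_derive (fun s => c s + d s)%C t (l + m)%C.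
Proof.
  intros [H1 H2] [H3 H4].
  split; now apply (is_derive_plus (K := R_AbsRing) (V := R_NormedModule)).
Qed.

Lemma curve_derive_mult (c d : R -> C) (t : R) (l m : C) :
  curve_derive c t l -> curve_derive d t m ->
  curve_derive (fun s => c s * d s)%C t (l * d t + c t * m)%C.
Proof.
  intros [H1 H2] [H3 H4]. split.
  - pose proof (is_derive_minus (K := R_AbsRing) (V := R_NormedModule) _ _ _ _ _
      (is_derive_mult (K := R_AbsRing) _ _ _ _ _ H1 H3 Rmult_comm)
      (is_derive_mult (K := R_AbsRing) _ _ _ _ _ H2 H4 Rmult_comm)) as H.
    eapply eq_rect; [exact H |]. unfold minus, plus, opp, mult; simpl. unfold Re, Im. ring.
  - pose proof (is_derive_plus (K := R_AbsRing) (V := R_NormedModule) _ _ _ _ _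
      (is_derive_mult (K := R_AbsRing) _ _ _ _ _ H1 H4 Rmult_comm)
      (is_derive_mult (K := R_AbsRing) _ _ _ _ _ H2 H3 Rmult_comm)) as H.
    eapply eq_rect; [exact H |]. unfold minus, plus, opp, mult; simpl. unfold Re, Im. ring.
Qed.

Lemma norm2_neq_0 (a : C) : a <> 0%C -> fst a ^ 2 + snd a ^ 2 <> 0.
Proof.
  intros Ha H. apply Ha. destruct a as [x y]. simpl in H.
  unfold RtoC. f_equal; nra.
Qed.

Lemma curve_derive_inv (c : R -> C) (t : R) (l : C) :
  c t <> 0%C -> curve_derive c t l ->
  curve_derive (fun s => / c s)%C t (- (l * (/ c t * / c t)))%C.
Proof.
  intros Hc [H1 H2]. pose proof (norm2_neq_0 _ Hc) as Hn.
  set (a := fun s => Re (c s)) in *. set (b := fun s => Im (c s)) in *.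
  change (a t ^ 2 + b t ^ 2 <> 0) in Hn.
  assert (E1 : Derive a t = Re l) by exact (is_derive_unique _ _ _ H1).
  assert (E2 : Derive b t = Im l) by exact (is_derive_unique _ _ _ H2).
  assert (X1 : ex_derive a t) by (eexists; exact H1).
  assert (X2 : ex_derive b t) by (eexists; exact H2).
  split.
  - change (is_derive (fun s => a s / (a s ^ 2 + b s ^ 2)) t
      (Re (- (l * (/ c t * / c t)))%C)).
    auto_derive; [tauto |]. change (Derive (fun x => a x) t) with (Derive a t).
    change (Derive (fun x => b x) t) with (Derive b t). rewrite E1, E2. unfold a, b, Re, Im in *.
    destruct (c t) as [u v], l as [l1 l2]. simpl in *. field. lra.
  - change (is_derive (fun s => - b s / (a s ^ 2 + b s ^ 2)) t
      (Im (- (l * (/ c t * / c t)))%C)).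
    auto_derive; [tauto |]. change (Derive (fun x => a x) t) with (Derive a t).
    change (Derive (fun x => b x) t) with (Derive b t). rewrite E1, E2. unfold a, b, Re, Im in *.
    destruct (c t) as [u v], l as [l1 l2]. simpl in *. field. lra.
Qed.

(** [g] and [h] are the derivatives of [f] in [z] and in its conjugate, encoded by [f_x = g + h] and
    [f_y = Ci * (g - h)]. As a relation it carries the existence of the partial derivatives, which
    [d_z] and [d_zbar] do not. *)
Definition wirtinger (f g h : C -> C) : Prop :=
  forall x y, unit_disk (x, y) ->
    curve_derive (fun t => f (t, y)) x (g (x, y) + h (x, y))%C /\
    curve_derive (fun t => f (x, t)) y (Ci * (g (x, y) - h (x, y)))%C.

Lemma wirtinger_const (c : C) : wirtinger (fun _ => c) (fun _ => 0%C) (fun _ => 0%C).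
Proof.
  intros x y _. replace (0 + 0)%C with (RtoC 0) by ring.
  replace (Ci * (0 - 0))%C with (RtoC 0) by ring. split; apply curve_derive_const.
Qed.

Lemma wirtinger_id : wirtinger (fun z => z) (fun _ => 1%C) (fun _ => 0%C).
Proof.
  intros x y _. split; split; cbn; auto_derive; trivial; ring.
Qed.

Lemma wirtinger_conj : wirtinger Cconj (fun _ => 0%C) (fun _ => 1%C).
Proof.
  intros x y _. split; split; cbn; auto_derive; trivial; ring.
Qed.

Lemma wirtinger_plus (f1 g1 h1 f2 g2 h2 : C -> C) :
  wirtinger f1 g1 h1 -> wirtinger f2 g2 h2 ->
  wirtinger (fun z => f1 z + f2 z)%C (fun z => g1 z + g2 z)%C (fun z => h1 z + h2 z)%C.
Proof.
  intros H1 H2 x y Hz. destruct (H1 x y Hz) as [A1 B1]. destruct (H2 x y Hz) as [A2 B2]. split.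
  - eapply curve_derive_eq; [exact (curve_derive_plus _ _ _ _ _ A1 A2) | cbv beta; ring].
  - eapply curve_derive_eq; [exact (curve_derive_plus _ _ _ _ _ B1 B2) | cbv beta; ring].
Qed.

Lemma wirtinger_mult (f1 g1 h1 f2 g2 h2 : C -> C) :
  wirtinger f1 g1 h1 -> wirtinger f2 g2 h2 ->
  wirtinger (fun z => f1 z * f2 z)%C (fun z => g1 z * f2 z + f1 z * g2 z)%C
    (fun z => h1 z * f2 z + f1 z * h2 z)%C.
Proof.
  intros H1 H2 x y Hz. destruct (H1 x y Hz) as [A1 B1]. destruct (H2 x y Hz) as [A2 B2]. split.
  - eapply curve_derive_eq; [exact (curve_derive_mult _ _ _ _ _ A1 A2) | cbv beta; ring].
  - eapply curve_derive_eq; [exact (curve_derive_mult _ _ _ _ _ B1 B2) | cbv beta; ring].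
Qed.

Lemma wirtinger_inv (f g h : C -> C) :
  (forall z, unit_disk z -> f z <> 0%C) -> wirtinger f g h ->
  wirtinger (fun z => / f z)%C (fun z => (- 1) * g z * (/ f z * / f z))%C
    (fun z => (- 1) * h z * (/ f z * / f z))%C.
Proof.
  intros Hf H x y Hz. destruct (H x y Hz) as [A B]. specialize (Hf _ Hz). split.
  - eapply curve_derive_eq; [exact (curve_derive_inv _ _ _ Hf A) | cbv beta; ring].
  - eapply curve_derive_eq; [exact (curve_derive_inv _ _ _ Hf B) | cbv beta; ring].
Qed.

Lemma unit_disk_locally (x y : R) : unit_disk (x, y) -> locally_2d (fun u v => unit_disk (u, v)) x y.
Proof.
  intros H. destruct (disk2_locally x y (proj2 (disk2_unit_disk x y) H)) as [d Hd].
  exists d. intros u v Hu Hv. apply disk2_unit_disk. now apply Hd.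
Qed.

(** The disc is open, so values on it determine the derivatives there. This permits iteration: after
    one [d_z] or [laplacian] the result is known on the disc only. *)
Lemma wirtinger_ext (f f' g g' h h' : C -> C) :
  (forall z, unit_disk z -> f' z = f z) -> (forall z, unit_disk z -> g' z = g z) ->
  (forall z, unit_disk z -> h' z = h z) -> wirtinger f g h -> wirtinger f' g' h'.
Proof.
  intros E Eg Eh H x y Hz. rewrite Eg, Eh by exact Hz.
  pose proof (unit_disk_locally x y Hz) as HL.
  pose proof (locally_2d_1d_const_y _ _ _ HL) as Lx.
  pose proof (locally_2d_1d_const_x _ _ _ HL) as Ly.
  destruct (H x y Hz) as [[A1 A2] [B1 B2]].
  split; split; (eapply is_derive_ext_loc; [| eassumption]).
  - revert Lx. apply filter_imp. intros t Ht. now rewrite E.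
  - revert Lx. apply filter_imp. intros t Ht. now rewrite E.
  - revert Ly. apply filter_imp. intros t Ht. now rewrite E.
  - revert Ly. apply filter_imp. intros t Ht. now rewrite E.
Qed.

Lemma wirtinger_partial_x (f g h : C -> C) (z : C) :
  wirtinger f g h -> unit_disk z -> partial_x f z = (g z + h z)%C.
Proof.
  intros H Hz. destruct z as [x y]. destruct (H x y Hz) as [[A1 A2] _].
  apply injective_projections; [exact (is_derive_unique _ _ _ A1) | exact (is_derive_unique _ _ _ A2)].
Qed.

Lemma wirtinger_partial_y (f g h : C -> C) (z : C) :
  wirtinger f g h -> unit_disk z -> partial_y f z = (Ci * (g z - h z))%C.
Proof.
  intros H Hz. destruct z as [x y]. destruct (H x y Hz) as [_ [B1 B2]].
  apply injective_projections; [exact (is_derive_unique _ _ _ B1) | exact (is_derive_unique _ _ _ B2)].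
Qed.

Lemma wirtinger_d_z (f g h : C -> C) (z : C) : wirtinger f g h -> unit_disk z -> d_z f z = g z.
Proof.
  intros H Hz. unfold d_z.
  rewrite (wirtinger_partial_x f g h z H Hz), (wirtinger_partial_y f g h z H Hz).
  apply injective_projections; simpl; field.
Qed.

Lemma wirtinger_d_zbar (f g h : C -> C) (z : C) :
  wirtinger f g h -> unit_disk z -> d_zbar f z = h z.
Proof.
  intros H Hz. unfold d_zbar.
  rewrite (wirtinger_partial_x f g h z H Hz), (wirtinger_partial_y f g h z H Hz).
  apply injective_projections; simpl; field.
Qed.

(* The rational functions of z, and of z and its conjugate when [b] is true. *)
Inductive rational (b : bool) : (C -> C) -> Prop :=
| rational_const : forall c, rational b (fun _ => c)
| rational_id : rational b (fun z => z)
| rational_conj : b = true -> rational b Cconj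
| rational_plus : forall f g : C -> C, rational b f -> rational b g -> rational b (fun z => f z + g z)%C
| rational_mult : forall f g : C -> C, rational b f -> rational b g -> rational b (fun z => f z * g z)%C
| rational_inv : forall f : C -> C, (forall z, unit_disk z -> f z <> 0%C) ->
    rational b f -> rational b (fun z => / f z)%C.

Lemma rational_pow (b : bool) (f : C -> C) (n : nat) :
  rational b f -> rational b (fun z => f z ^ n)%C.
Proof.
  intros Hf. induction n as [| n IH]; simpl.
  - apply rational_const.
  - now apply rational_mult.
Qed.

Lemma rational_true (b : bool) (f : C -> C) : rational b f -> rational true f.
Proof.
  induction 1; auto using rational_const, rational_id, rational_conj, rational_plus,
    rational_mult, rational_inv.
Qed.

(** Stability of the class under both derivatives: it gives smoothness of every order by induction,
    and without the conjugate it gives the Cauchy-Riemann equation [h = 0]. *)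
Lemma rational_wirtinger (b : bool) (f : C -> C) : rational b f ->
  exists g h, rational b g /\ rational b h /\ wirtinger f g h /\ (b = false -> forall z, h z = 0%C).
Proof.
  induction 1 as [c | | Hb | f1 f2 _ [g1 [h1 (R1 & S1 & W1 & Z1)]] _ [g2 [h2 (R2 & S2 & W2 & Z2)]]
    | f1 f2 F1 [g1 [h1 (R1 & S1 & W1 & Z1)]] F2 [g2 [h2 (R2 & S2 & W2 & Z2)]]
    | f Hf F [g [h (R & S & W & Z)]]].
  - do 2 eexists. split; [| split; [| split; [apply wirtinger_const | trivial]]]; apply rational_const.
  - do 2 eexists. split; [| split; [| split; [apply wirtinger_id | trivial]]]; apply rational_const.
  - do 2 eexists. split; [| split; [| split; [apply wirtinger_conj | congruence]]];
      apply rational_const.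
  - do 2 eexists. split; [| split; [| split; [exact (wirtinger_plus _ _ _ _ _ _ W1 W2) |]]].
    + now apply rational_plus.
    + now apply rational_plus.
    + intros Hb z. cbv beta. rewrite Z1, Z2 by exact Hb. ring.
  - do 2 eexists. split; [| split; [| split; [exact (wirtinger_mult _ _ _ _ _ _ W1 W2) |]]].
    + apply rational_plus; now apply rational_mult.
    + apply rational_plus; now apply rational_mult.
    + intros Hb z. cbv beta. rewrite Z1, Z2 by exact Hb. ring.
  - do 2 eexists. split; [| split; [| split; [exact (wirtinger_inv _ _ _ Hf W) |]]].
    + repeat apply rational_mult; auto using rational_const, rational_inv.
    + repeat apply rational_mult; auto using rational_const, rational_inv.
    + intros Hb z. cbv beta. rewrite Z by exact Hb. ring.
Qed.

Lemma rational_continuous (b : bool) (f : C -> C) (x y : R) : rational b f -> unit_disk (x, y) ->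
  continuity_2d_pt (re_part f) x y /\ continuity_2d_pt (im_part f) x y.
Proof.
  intros Hf Hz.
  induction Hf as [c | | _ | f1 f2 _ [A1 B1] _ [A2 B2] | f1 f2 _ [A1 B1] _ [A2 B2] | f Hf _ [A B]].
  - split; apply continuity_2d_pt_const.
  - split; [apply continuity_2d_pt_id1 | apply continuity_2d_pt_id2].
  - split; [apply continuity_2d_pt_id1 | apply continuity_2d_pt_opp, continuity_2d_pt_id2].
  - split; now apply continuity_2d_pt_plus.
  - split.
    + apply continuity_2d_pt_minus; now apply continuity_2d_pt_mult.
    + apply continuity_2d_pt_plus; now apply continuity_2d_pt_mult.
  - pose proof (norm2_neq_0 _ (Hf _ Hz)) as Hn.
    assert (HN : continuity_2d_pt (fun u v => / (re_part f u v ^ 2 + im_part f u v ^ 2)) x y).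
    { apply continuity_2d_pt_inv; [| exact Hn].
      apply (continuity_2d_pt_ext
        (fun u v => re_part f u v * re_part f u v + im_part f u v * im_part f u v)).
      - intros u v. ring.
      - apply continuity_2d_pt_plus; now apply continuity_2d_pt_mult. }
    split.
    + now apply continuity_2d_pt_mult.
    + apply continuity_2d_pt_mult; [now apply continuity_2d_pt_opp | exact HN].
Qed.

Lemma rational_class_C (b : bool) (n : nat) (f : C -> C) : rational b f -> class_C n unit_disk f.
Proof.
  intros Hf0. apply rational_true in Hf0. revert f Hf0. induction n as [| n IH]; intros f Hf z Hz.
  - destruct z as [x y]. destruct (rational_continuous _ f x y Hf Hz) as [A B]. simpl. tauto.
  - destruct z as [x y]. destruct (rational_continuous _ f x y Hf Hz) as [A B].
    destruct (rational_wirtinger _ f Hf) as [g [h (Rg & Rh & W & _)]].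
    pose proof (IH _ (rational_plus _ _ _ Rg Rh) (x, y) Hz) as [I1 I2].
    (* The y-derivative [Ci * (g - h)], its difference written with [(- 1)] because [rational] is
       generated by sums, products and inverses. *)
    pose proof (IH _ (rational_mult _ _ _ (rational_const _ Ci)
      (rational_plus _ _ _ Rg (rational_mult _ _ _ (rational_const _ (- 1)%C) Rh)))
      (x, y) Hz) as [J1 J2].
    pose proof (unit_disk_locally x y Hz) as HL.
    destruct (W x y Hz) as [[D1 D2] [E1 E2]].
    assert (EQ : forall u v, unit_disk (u, v) ->
      Derive (fun t => re_part f t v) u = Re (g (u, v) + h (u, v))%C /\
      Derive (fun t => im_part f t v) u = Im (g (u, v) + h (u, v))%C /\
      Derive (fun t => re_part f u t) v = Re (Ci * (g (u, v) + (- 1) * h (u, v)))%C /\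
      Derive (fun t => im_part f u t) v = Im (Ci * (g (u, v) + (- 1) * h (u, v)))%C).
    { intros u v Huv. destruct (W u v Huv) as [[K1 K2] [K3 K4]].
      replace (g (u, v) + (- 1) * h (u, v))%C with (g (u, v) - h (u, v))%C by ring.
      repeat split; now apply is_derive_unique. }
    cbn [Re Im fst snd] in *.
    split; (split; [assumption | split; [eexists; eassumption | split; [eexists; eassumption |]]]);
      split.
    + apply (ex_diff_n_ext_loc (re_part (fun z => g z + h z)%C)); [| exact I1].
      destruct HL as [d Hd]. exists d. intros u v Hu Hv. symmetry. apply EQ; auto.
    + apply (ex_diff_n_ext_loc (re_part (fun z => Ci * (g z + (- 1) * h z))%C)); [| exact J1].
      destruct HL as [d Hd]. exists d. intros u v Hu Hv. symmetry. apply EQ; auto.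
    + apply (ex_diff_n_ext_loc (im_part (fun z => g z + h z)%C)); [| exact I2].
      destruct HL as [d Hd]. exists d. intros u v Hu Hv. symmetry. apply EQ; auto.
    + apply (ex_diff_n_ext_loc (im_part (fun z => Ci * (g z + (- 1) * h z))%C)); [| exact J2].
      destruct HL as [d Hd]. exists d. intros u v Hu Hv. symmetry. apply EQ; auto.
Qed.

(** * Polyanalytic functions: iterated Laplacians and Taylor coefficients *)

Lemma wirtinger_analytic (f : C -> C) : rational false f ->
  exists g, rational false g /\ wirtinger f g (fun _ => 0%C).
Proof.
  intros Hf. destruct (rational_wirtinger _ f Hf) as [g [h (Rg & _ & W & Z)]].
  exists g. split; [exact Rg |]. apply (wirtinger_ext f f g g h); trivial.
  intros z _. now rewrite Z.
Qed.

Lemma wirtinger_pow (f g h : C -> C) (n : nat) : wirtinger f g h ->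
  wirtinger (fun z => f z ^ S n)%C (fun z => INR (S n) * f z ^ n * g z)%C
    (fun z => INR (S n) * f z ^ n * h z)%C.
Proof.
  intros W. induction n as [| n IH].
  - apply (wirtinger_ext f _ g _ h); trivial; intros z _; simpl; ring.
  - pose proof (wirtinger_mult _ _ _ _ _ _ W IH) as W'.
    refine (wirtinger_ext _ _ _ _ _ _ _ _ _ W'); intros z _; rewrite ?(S_INR (S n)), ?RtoC_plus;
      simpl Cpow; ring.
Qed.

Lemma wirtinger_conj_pow_mult (f g : C -> C) (n : nat) : wirtinger f g (fun _ => 0%C) ->
  wirtinger (fun z => Cconj z ^ S n * f z)%C (fun z => Cconj z ^ S n * g z)%C
    (fun z => INR (S n) * Cconj z ^ n * f z)%C.
Proof.
  intros W. pose proof (wirtinger_mult _ _ _ _ _ _ (wirtinger_pow _ _ _ n wirtinger_conj) W) as W'.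
  refine (wirtinger_ext _ _ _ _ _ _ _ _ _ W'); intros z _; ring.
Qed.

(** The conjugate derivative kills the analytic [h] and lowers the power by one; the z-derivative
    then sees only [g]. *)
Lemma laplacian_conj_pow (j : nat) (f g g' h : C -> C) (z : C) :
  wirtinger g g' (fun _ => 0%C) -> rational false h ->
  (forall z, unit_disk z -> f z = Cconj z ^ S j * g z + h z)%C -> unit_disk z ->
  laplacian f z = (4 * INR (S j) * (Cconj z ^ j * g' z))%C.
Proof.
  intros Wg Hh E Hz. destruct (wirtinger_analytic h Hh) as [h' [_ Wh]].
  pose proof (wirtinger_plus _ _ _ _ _ _ (wirtinger_conj_pow_mult _ _ j Wg) Wh) as Wf.
  assert (Ezb : forall z, unit_disk z -> d_zbar f z = (INR (S j) * (Cconj z ^ j * g z))%C).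
  { intros u Hu. rewrite (wirtinger_d_zbar f _ _ u (wirtinger_ext _ _ _ _ _ _ E
      (fun _ _ => eq_refl) (fun _ _ => eq_refl) Wf) Hu). ring. }
  (* Only the z-derivative is needed, so the other one stays an unspecified [k]. The power 0 is
     treated apart because the product rule for conjugate powers is stated for positive
     exponents. *)
  assert (exists k, wirtinger (fun z => Cconj z ^ j * g z)%C (fun z => Cconj z ^ j * g' z)%C k)
    as [k Wk].
  { destruct j as [| j].
    - exists (fun _ => 0%C).
      refine (wirtinger_ext _ _ _ _ _ _ _ _ _ Wg); intros u _; simpl; ring.
    - eexists. apply (wirtinger_conj_pow_mult _ _ j Wg). }
  pose proof (wirtinger_mult _ _ _ _ _ _ (wirtinger_const (INR (S j))) Wk) as Wd.
  unfold laplacian.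
  rewrite (wirtinger_d_z (d_zbar f) _ _ z (wirtinger_ext _ _ _ _ _ _ Ezb
      (fun _ _ => eq_refl) (fun _ _ => eq_refl) Wd) Hz). ring.
Qed.

Lemma laplacian_analytic (f h : C -> C) (z : C) :
  rational false h -> (forall z, unit_disk z -> f z = h z) -> unit_disk z -> laplacian f z = 0%C.
Proof.
  intros Hh E Hz. destruct (wirtinger_analytic h Hh) as [h' [_ Wh]].
  unfold laplacian. rewrite (wirtinger_d_z (d_zbar f) (fun _ => 0%C) (fun _ => 0%C) z); trivial.
  - ring.
  - apply (wirtinger_ext (fun _ => 0%C) _ (fun _ => 0%C) _ (fun _ => 0%C)); trivial.
    + intros u Hu. apply (wirtinger_d_zbar f h' (fun _ => 0%C) u); trivial.
      apply (wirtinger_ext h _ h' _ (fun _ => 0%C)); trivial.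
    + apply wirtinger_const.
Qed.

(** Each Laplacian lowers the degree in the conjugate by one, and one more kills the analytic
    function that is left. *)
Lemma iter_laplacian_polyanalytic (j : nat) (f g h : C -> C) (z : C) :
  rational false g -> rational false h ->
  (forall z, unit_disk z -> f z = Cconj z ^ j * g z + h z)%C -> unit_disk z ->
  Nat.iter (S j) laplacian f z = 0%C.
Proof.
  revert f g h z. induction j as [| j IH]; intros f g h z Hg Hh E Hz.
  - apply (laplacian_analytic f (fun z => g z + h z)%C); trivial.
    + now apply rational_plus.
    + intros u Hu. rewrite E by exact Hu. simpl. ring.
  - rewrite Nat.iter_succ_r. destruct (wirtinger_analytic g Hg) as [g' [Hg' Wg]].
    apply (IH _ (fun z => 4 * INR (S j) * g' z)%C (fun _ => 0%C)); trivial.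
    + apply rational_mult; [apply rational_const | exact Hg'].
    + apply rational_const.
    + intros u Hu. rewrite (laplacian_conj_pow j f g g' h u Wg Hh E Hu). ring.
Qed.

Lemma unit_disk_0 : unit_disk 0%C.
Proof. unfold unit_disk. rewrite Cmod_0. lra. Qed.

(** The shape is preserved: the remainder loses one power of [z], and the conjugate factor, constant
    for [d_z], keeps its positive power and so vanishes at 0. For [m = 0] the exponent [pred 0] is
    harmless, its coefficient being [INR 0]. *)
Lemma d_z_taylor (m j : nat) (c a : C) (f g h : C -> C) :
  rational false g -> rational false h ->
  (forall z, unit_disk z -> f z = c + a * z ^ m + z ^ S m * h z + Cconj z ^ S j * g z)%C ->
  exists g' h', rational false g' /\ rational false h' /\
    forall z, unit_disk z -> d_z f z =
      (INR m * a * z ^ pred m + z ^ m * h' z + Cconj z ^ S j * g' z)%C.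
Proof.
  intros Hg Hh E.
  destruct (wirtinger_analytic g Hg) as [g' [Hg' Wg]].
  destruct (wirtinger_analytic h Hh) as [h' [Hh' Wh]].
  exists g', (fun z => INR (S m) * h z + z * h' z)%C. split; [exact Hg' |]. split.
  { apply rational_plus; apply rational_mult; auto using rational_const, rational_id. }
  intros u Hu.
  assert (exists k, wirtinger (fun z => a * z ^ m)%C (fun z => INR m * a * z ^ pred m)%C k)
    as [k Wk].
  { destruct m as [| m]; eexists.
    - refine (wirtinger_ext _ _ _ _ _ _ _ _ _ (wirtinger_const a)); intros v _; simpl; try ring.
      reflexivity.
    - refine (wirtinger_ext _ _ _ _ _ _ _ _ _ (wirtinger_mult _ _ _ _ _ _ (wirtinger_const a)
        (wirtinger_pow _ _ _ m wirtinger_id))); intros v _; simpl pred; try ring. reflexivity. }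
  pose proof (wirtinger_plus _ _ _ _ _ _ (wirtinger_plus _ _ _ _ _ _
    (wirtinger_plus _ _ _ _ _ _ (wirtinger_const c) Wk)
    (wirtinger_mult _ _ _ _ _ _ (wirtinger_pow _ _ _ m wirtinger_id) Wh))
    (wirtinger_conj_pow_mult _ _ j Wg)) as Wf.
  rewrite (wirtinger_d_z f _ _ u (wirtinger_ext _ _ _ _ _ _ E
      (fun _ _ => eq_refl) (fun _ _ => eq_refl) Wf) Hu).
  simpl Cpow. ring.
Qed.

Lemma iter_d_z_taylor (m j : nat) (a : C) (f g h : C -> C) :
  rational false g -> rational false h ->
  (forall z, unit_disk z -> f z = a * z ^ m + z ^ S m * h z + Cconj z ^ S j * g z)%C ->
  Nat.iter m d_z f 0%C = (a * INR (fact m))%C.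
Proof.
  revert a f g h. induction m as [| m IH]; intros a f g h Hg Hh E.
  - simpl. rewrite (E _ unit_disk_0). simpl.
    replace (Cconj 0) with (RtoC 0) by (apply injective_projections; simpl; ring). ring.
  - rewrite Nat.iter_succ_r.
    destruct (d_z_taylor (S m) j 0%C a f g h Hg Hh) as [g' [h' (Hg' & Hh' & E')]].
    { intros z Hz. rewrite E by exact Hz. ring. }
    rewrite (IH (INR (S m) * a)%C _ g' h'); trivial.
    rewrite fact_simpl, mult_INR, RtoC_mult. ring.
Qed.

(** A constant term disappears at the first derivative, hence the order [S m]; at order 0 it would
    contribute to the value. *)
Lemma iter_d_z_taylor_const (m j : nat) (c a : C) (f g h : C -> C) :
  rational false g -> rational false h ->
  (forall z, unit_disk z ->
     f z = c + a * z ^ S m + z ^ S (S m) * h z + Cconj z ^ S j * g z)%C ->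
  Nat.iter (S m) d_z f 0%C = (a * INR (fact (S m)))%C.
Proof.
  intros Hg Hh E. rewrite Nat.iter_succ_r.
  destruct (d_z_taylor (S m) j c a f g h Hg Hh E) as [g' [h' (Hg' & Hh' & E')]].
  rewrite (iter_d_z_taylor m j (INR (S m) * a)%C _ g' h'); trivial.
  rewrite fact_simpl, mult_INR, RtoC_mult. ring.
Qed.

(** * The extremal functions *)

(* The shape of [f z = c * (1 - c * Cconj z ^ n) / (1 - Cconj c * z ^ n)] with [c] unimodular,
   and of the convex combinations of such functions. *)
Definition extremal_shape (n : nat) (c : C) (f : C -> C) : Prop :=
  exists (b : C) (h k : C -> C), rational false h /\ rational false k /\
    forall z, unit_disk z -> f z =
      (c + z ^ n + z ^ S n * h z + Cconj z ^ n * (b - c * z ^ n + z ^ S n * k z))%C.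

(** The prescribed coefficients are affine in [c]; weights of sum 1 keep the coefficient of [z ^ n]
    equal to 1 and the mixed one equal to minus the constant term. *)
Lemma extremal_shape_combination (n : nat) (l1 l2 : R) (c1 c2 : C) (f1 f2 : C -> C) :
  l1 + l2 = 1 -> extremal_shape n c1 f1 -> extremal_shape n c2 f2 ->
  extremal_shape n (l1 * c1 + l2 * c2)%C (fun z => l1 * f1 z + l2 * f2 z)%C.
Proof.
  intros Hl (b1 & h1 & k1 & Rh1 & Rk1 & E1) (b2 & h2 & k2 & Rh2 & Rk2 & E2).
  exists (l1 * b1 + l2 * b2)%C, (fun z => l1 * h1 z + l2 * h2 z)%C,
    (fun z => l1 * k1 z + l2 * k2 z)%C.
  split; [| split]; [| | intros z Hz].
  1, 2: apply rational_plus; apply rational_mult; auto using rational_const.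
  rewrite E1, E2 by exact Hz. replace l2 with (1 - l1) by lra. rewrite RtoC_minus. ring.
Qed.

Lemma extremal_shape_calH (m : nat) (c : C) (f : C -> C) :
  rational true f -> extremal_shape (S m) c f -> (forall z, unit_disk z -> Cmod (f z) <= 1) ->
  calH (S (S m)) f /\ ~ calH (S m) f.
Proof.
  intros Rf (b & h & k & Rh & Rk & E) Hb.
  set (g := fun z => (b + (- c) * z ^ S m + z ^ S (S m) * k z)%C).
  assert (Rg : rational false g).
  { repeat apply rational_plus; auto using rational_const.
    - apply rational_mult; [apply rational_const | apply (rational_pow _ (fun z => z)), rational_id].
    - apply rational_mult; [apply (rational_pow _ (fun z => z)), rational_id | exact Rk]. }
  assert (Rpow : forall n, rational false (fun z => z ^ n)%C).
  { intros n. apply (rational_pow _ (fun z => z)), rational_id. }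
  assert (E' : forall z, unit_disk z ->
    f z = (c + 1 * z ^ S m + z ^ S (S m) * h z + Cconj z ^ S m * g z)%C).
  { intros z Hz. rewrite E by exact Hz. unfold g. ring. }
  split.
  - split; [split |].
    + now apply (rational_class_C true).
    + intros z Hz.
      apply (iter_laplacian_polyanalytic (S m) f g (fun z => c + z ^ S m + z ^ S (S m) * h z)%C);
        trivial.
      * apply rational_plus; [apply rational_plus | apply rational_mult];
          auto using rational_const.
      * intros u Hu. rewrite E' by exact Hu. ring.
    + split; [| exact Hb].
      rewrite (iter_d_z_taylor_const m m c 1%C f g h Rg Rh E'). ring.
  - intros [[_ HL] [HD _]]. destruct m as [| m].
    (* Here [n = 1]: the normalization of the smaller class forces [c = 1], and the Laplacian at 0
       equals [4 * d_z g 0 = - 4]. *)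
    + simpl in HD. rewrite (E _ unit_disk_0) in HD. simpl in HD.
      assert (Hc : c = RtoC 1).
      { transitivity (c + 0 * 1 + 0 * (0 * 1) * h 0%C + Cconj 0 * 1 * (b - c * (0 * 1) + 0 * (0 * 1) * k 0%C))%C.
        - replace (Cconj 0) with (RtoC 0) by (apply injective_projections; simpl; ring). ring.
        - exact HD. }
      destruct (wirtinger_analytic g Rg) as [g' [_ Wg]].
      pose proof (HL _ unit_disk_0) as HL0. simpl in HL0.
      rewrite (laplacian_conj_pow 0 f g g' (fun z => c + z ^ 1 + z ^ 2 * h z)%C _ Wg) in HL0.
      * rewrite <- (wirtinger_d_z g g' _ 0%C Wg unit_disk_0) in HL0.
        pose proof (iter_d_z_taylor_const 0 0 b (- c)%C g (fun _ => 0%C) k (rational_const _ _) Rk)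
          as Hg.
        simpl Nat.iter in Hg. rewrite Hg, Hc in HL0.
        -- apply (f_equal Re) in HL0. simpl in HL0. lra.
        -- intros z _. unfold g. ring.
      * apply rational_plus; [apply rational_plus | apply rational_mult];
          auto using rational_const.
      * intros u Hu. rewrite E' by exact Hu. ring.
      * exact unit_disk_0.
    (* Here [n >= 2]: the derivative of order [n - 1] at 0 has coefficient 0, the term [z ^ n] being
       absorbed into the remainder as [1 + z * h z]. *)
    + rewrite (iter_d_z_taylor_const m (S m) c 0%C f g (fun z => 1 + z * h z)%C Rg) in HD.
      * rewrite Cmult_0_l in HD. apply (f_equal Re) in HD.
        exact (INR_fact_neq_0 (S m) (eq_sym HD)).
      * apply rational_plus; [apply rational_const | apply rational_mult; auto using rational_id].
      * intros z Hz. rewrite E' by exact Hz. simpl. ring.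
Qed.

(** With [D = 1 - Cconj c * z ^ n] this is [c * Cconj D / D]. In the geometric series of [c / D] the
    coefficient of [z ^ n] is [c * Cconj c], which is 1 for unimodular [c]. *)
Definition kernel (n : nat) (c z : C) : C :=
  (c * (1 - c * Cconj z ^ n) * / (1 - Cconj c * z ^ n))%C.

Lemma Cmod_1_conj (c : C) : Cmod c = 1 -> (c * Cconj c)%C = RtoC 1.
Proof. intros Hc. rewrite <- Cmod2_conj, Hc. f_equal. ring. Qed.

Lemma unit_disk_pow (m : nat) (z : C) : unit_disk z -> unit_disk (z ^ S m)%C.
Proof.
  unfold unit_disk. intros Hz. rewrite Cmod_pow. pose proof (Cmod_ge_0 z).
  apply pow_lt_1_compat; [lra | lia].
Qed.

Lemma one_minus_neq_0 (z : C) : unit_disk z -> (1 - z)%C <> 0%C.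
Proof.
  unfold unit_disk. intros Hz H. replace z with (RtoC 1) in Hz.
  - rewrite Cmod_1 in Hz. lra.
  - transitivity (z + (1 - z))%C; [ring | rewrite H; ring].
Qed.

Lemma kernel_denominator (m : nat) (c z : C) : Cmod c = 1 -> unit_disk z ->
  (1 - Cconj c * z ^ S m)%C <> 0%C.
Proof.
  intros Hc Hz. apply one_minus_neq_0. pose proof (unit_disk_pow m z Hz) as H.
  unfold unit_disk in *. rewrite Cmod_mult, Cmod_conj, Hc. lra.
Qed.

Lemma Cmod_kernel (m : nat) (c z : C) : Cmod c = 1 -> unit_disk z -> Cmod (kernel (S m) c z) = 1.
Proof.
  intros Hc Hz. pose proof (kernel_denominator m c z Hc Hz) as Hd.
  unfold kernel. rewrite !Cmod_mult, Cmod_inv, Hc by exact Hd.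
  replace (1 - c * Cconj z ^ S m)%C with (Cconj (1 - Cconj c * z ^ S m)).
  - rewrite Cmod_conj. field. intros H. now apply Cmod_eq_0 in H.
  - rewrite Cminus_conj, Cmult_conj, Cpow_conj, Cconj_conj. f_equal.
    apply injective_projections; simpl; ring.
Qed.

(* [r = 1 / (1 - Cconj c * z ^ n)] satisfies [r = 1 + Cconj c * z ^ n * r]; iterating this
   identity gives the Taylor expansion to the required order. *)
Lemma kernel_shape (m : nat) (c : C) : Cmod c = 1 ->
  rational true (kernel (S m) c) /\ extremal_shape (S m) c (kernel (S m) c).
Proof.
  intros Hc. pose proof (Cmod_1_conj c Hc) as Hcc.
  set (r := fun z => (/ (1 + (- Cconj c) * z ^ S m))%C).
  assert (Hd : forall z, unit_disk z -> (1 + (- Cconj c) * z ^ S m)%C <> 0%C).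
  { intros z Hz. pose proof (kernel_denominator m c z Hc Hz) as H.
    replace (1 + (- Cconj c) * z ^ S m)%C with (1 - Cconj c * z ^ S m)%C by ring. exact H. }
  assert (Hpow : forall b n, rational b (fun z => z ^ n)%C).
  { intros b n. apply (rational_pow _ (fun z => z)), rational_id. }
  assert (Rr : forall b, rational b r).
  { intros b. apply (rational_inv b (fun z => 1 + (- Cconj c) * z ^ S m)%C Hd).
    apply rational_plus; [| apply rational_mult]; auto using rational_const. }
  (* An equality of functions, since [rational] concerns the function itself and has no constructor
     for pointwise equality. *)
  assert (E : kernel (S m) c = fun z => (c * (1 + (- c) * Cconj z ^ S m) * r z)%C).
  { apply functional_extensionality. intros z. unfold kernel, r.
    f_equal; [| f_equal]; ring. }
  rewrite E. split.
  - apply rational_mult; [apply rational_mult; [apply rational_const |] | apply Rr].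
    apply rational_plus; [apply rational_const | apply rational_mult; [apply rational_const |]].
    now apply (rational_pow _ Cconj), rational_conj.
  - exists (- c * c)%C, (fun z => Cconj c * (z ^ m * r z))%C,
      (fun z => (- 1) * (z ^ m * r z))%C.
    split; [| split].
    1, 2: apply rational_mult; [apply rational_const | now apply rational_mult].
    intros z Hz.
    assert (Er : r z = (1 + Cconj c * z ^ S m * r z)%C).
    { unfold r. field. exact (Hd z Hz). }
    (* [z ^ S (S m) * z ^ m] is the square of [z ^ S m], split to exhibit the factor that the shape
       requires. *)
    assert (Er2 : r z = (1 + Cconj c * z ^ S m + Cconj c * Cconj c * (z ^ S (S m) * z ^ m) * r z)%C).
    { rewrite Er at 1. rewrite Er at 1. simpl Cpow. ring. }
    rewrite Er2 at 1.
    transitivity (c + (c * Cconj c) * z ^ S m + z ^ S (S m) * ((c * Cconj c) * Cconj c * (z ^ m * r z))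
      + Cconj z ^ S m * (- c * c - (c * Cconj c) * c * z ^ S m
      + z ^ S (S m) * ((- 1) * ((c * Cconj c) * (c * Cconj c)) * (z ^ m * r z))))%C;
      [ring |]. rewrite Hcc. ring.
Qed.

(* With [k = w * e^2] the equation says that [e * (1 - k * Cconj z)] is real; its imaginary part
   changes sign when [e] runs from [- Ci] to [Ci] along the right half of the unit circle. *)
Lemma kernel_value_onto_circle (z w : C) : unit_disk z -> Cmod w = 1 ->
  exists k, Cmod k = 1 /\ (k * (1 - k * Cconj z) * / (1 - Cconj k * z))%C = w.
Proof.
  intros Hz Hw.
  set (d := (w * Cconj z)%C).
  assert (Hd : -1 < Re d < 1).
  { assert (H1 : Cmod d < 1).
    { unfold d. rewrite Cmod_mult, Cmod_conj, Hw. unfold unit_disk in Hz. lra. }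
    pose proof (Rmax_Cmod d) as H2. pose proof (Rmax_l (Rabs (fst d)) (Rabs (snd d))) as H3.
    apply Rabs_lt_between. unfold Re. lra. }
  set (e := fun s => (cos s, sin s) : C).
  set (p := fun s => Im (e s * (1 - d * (e s * e s)))%C).
  assert (Ep : forall s, p s =
    sin s * (1 - (Re d * (cos s * cos s - sin s * sin s) - Im d * (2 * cos s * sin s)))
    - cos s * (Re d * (2 * cos s * sin s) + Im d * (cos s * cos s - sin s * sin s))).
  { intros s. unfold p, e, Re, Im. destruct d. simpl. ring. }
  assert (Cp : continuity p).
  { rewrite (functional_extensionality _ _ Ep). reg. }
  (* At the two ends [p] equals [- (1 + Re d)] and [1 + Re d], of opposite signs because [d] lies in
     the disc. *)
  destruct (IVT p (- (PI / 2)) (PI / 2) Cp) as [s [_ Hs]].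
  - pose proof PI_RGT_0. lra.
  - rewrite Ep, cos_neg, sin_neg, cos_PI2, sin_PI2. lra.
  - rewrite Ep, cos_PI2, sin_PI2. lra.
  - set (k := (w * (e s * e s))%C). exists k.
    assert (He : Cmod (e s) = 1).
    { unfold Cmod, e. cbn [fst snd].
      replace (cos s ^ 2 + sin s ^ 2) with 1; [apply sqrt_1 |].
      pose proof (sin2_cos2 s) as H. unfold Rsqr in H. lra. }
    assert (Hk : Cmod k = 1) by (unfold k; rewrite !Cmod_mult, Hw, He; ring).
    split; [exact Hk |].
    pose proof (kernel_denominator 0 k z Hk Hz) as Hn.
    replace (z ^ 1)%C with z in Hn by (simpl; ring).
    set (u := (1 - k * Cconj z)%C).
    assert (Hu : (1 - Cconj k * z)%C = Cconj u).
    { unfold u. rewrite Cminus_conj, Cmult_conj, Cconj_conj. f_equal.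
      apply injective_projections; simpl; ring. }
    assert (Hreal : (e s * u)%C = Cconj (e s * u)).
    { assert (Him : Im (e s * u)%C = 0).
      { rewrite <- Hs. unfold p, u, k, d. f_equal. ring. }
      apply injective_projections; [reflexivity |].
      change (Im (e s * u)%C = - Im (e s * u)%C). rewrite Him. ring. }
    rewrite Cmult_conj in Hreal.
    rewrite Hu in Hn |- *.
    (* Since [e s * u] is real, it may be replaced by its conjugate; [Cconj u] then cancels the
       denominator and [e s * Cconj (e s) = 1] leaves [w]. *)
    transitivity (w * (e s * (e s * u)) * / Cconj u)%C; [unfold k; ring |].
    rewrite Hreal.
    transitivity (w * (e s * Cconj (e s)) * (Cconj u * / Cconj u))%C; [ring |].
    rewrite (Cmod_1_conj _ He), Cinv_r by exact Hn. ring.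
Qed.

(** * The closed disc as the set of values *)

Lemma closure_unit_disk (w : C) : closure unit_disk w <-> Cmod w <= 1.
Proof.
  split.
  - intros H. apply Rnot_lt_le. intros Hw. destruct w as [x y].
    assert (Hxy : 1 < x * x + y * y).
    { unfold Cmod in Hw. cbn [fst snd] in Hw. rewrite <- sqrt_1 in Hw at 1.
      apply sqrt_lt_0_alt in Hw. lra. }
    pose proof (proj1 (continuity_2d_pt_iff_continuous _ _ _) (continuity_2d_pt_norm2 x y)) as HC.
    destruct (H _ (HC (fun r => 1 < r) (open_gt 1 _ Hxy))) as [[u v] [Hz Hz']].
    apply disk2_unit_disk in Hz. unfold disk2 in Hz. cbn [fst snd] in Hz'. lra.
  - intros Hw P [d Hd].
    (* Shrinking [w] by a factor below 1 brings it into the open disc and moves each coordinate by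
       at most [d / 2]; the maximum with 0 covers large [d]. *)
    set (t := Rmax 0 (1 - d / 2)).
    pose proof (cond_pos d) as Hpos.
    assert (Ht : 0 <= t < 1) by (unfold t; split; [apply Rmax_l | apply Rmax_lub_lt; lra]).
    assert (Ht' : 1 - d / 2 <= t) by apply Rmax_r.
    exists (t * w)%C. split.
    + unfold unit_disk. rewrite Cmod_mult, Cmod_R, Rabs_pos_eq by lra.
      pose proof (Cmod_ge_0 w). nra.
    + apply Hd.
      pose proof (Rmax_Cmod w) as HR.
      pose proof (Rmax_l (Rabs (fst w)) (Rabs (snd w))).
      pose proof (Rmax_r (Rabs (fst w)) (Rabs (snd w))).
      split; simpl; unfold ball; simpl; unfold AbsRing_ball, abs, minus, plus, opp; simpl.
      * replace (t * fst w - 0 * snd w + - fst w) with ((t - 1) * fst w) by ring.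
        rewrite Rabs_mult, (Rabs_left (t - 1)) by lra. pose proof (Rabs_pos (fst w)). nra.
      * replace (t * snd w + 0 * fst w + - snd w) with ((t - 1) * snd w) by ring.
        rewrite Rabs_mult, (Rabs_left (t - 1)) by lra. pose proof (Rabs_pos (snd w)). nra.
Qed.

Lemma polar_decomposition (w : C) : exists e, Cmod e = 1 /\ w = (Cmod w * e)%C.
Proof.
  destruct (Req_dec (Cmod w) 0) as [H | H].
  - exists (RtoC 1). split; [apply Cmod_1 |]. rewrite H. apply Cmod_eq_0 in H. rewrite H. ring.
  - exists (w * / Cmod w)%C.
    assert (H' : RtoC (Cmod w) <> 0%C) by (intros E; apply H; now injection E).
    split.
    + rewrite Cmod_mult, Cmod_inv, Cmod_R, Rabs_pos_eq by (trivial; apply Cmod_ge_0). now field.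
    + field. exact H'.
Qed.

Lemma V_onto (m : nat) (z0 w : C) : unit_disk z0 -> Cmod w <= 1 -> V (S (S m)) z0 w.
Proof.
  intros Hz0 Hw. destruct (polar_decomposition w) as [e [He Ew]].
  pose proof (unit_disk_pow m z0 Hz0) as Hzm.
  destruct (kernel_value_onto_circle (z0 ^ S m)%C e Hzm He) as [k1 [Hk1 E1]].
  destruct (kernel_value_onto_circle (z0 ^ S m)%C (- e)%C Hzm) as [k2 [Hk2 E2]].
  { now rewrite Cmod_opp. }
  rewrite Cpow_conj in E1, E2.
  change (kernel (S m) k1 z0 = e) in E1. change (kernel (S m) k2 z0 = (- e)%C) in E2.
  destruct (kernel_shape m k1 Hk1) as [R1 S1]. destruct (kernel_shape m k2 Hk2) as [R2 S2].
  pose proof (Cmod_ge_0 w) as Hw0.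
  (* [w = Cmod w * e] lies on the diameter from [- e] to [e]; these weights solve [l1 + l2 = 1] and
     [l1 - l2 = Cmod w]. *)
  set (l1 := (1 + Cmod w) / 2). set (l2 := (1 - Cmod w) / 2).
  assert (Hl1 : 0 <= l1) by (unfold l1; lra). assert (Hl2 : 0 <= l2) by (unfold l2; lra).
  assert (Hl : l1 + l2 = 1) by (unfold l1, l2; lra).
  set (f := fun z => (l1 * kernel (S m) k1 z + l2 * kernel (S m) k2 z)%C).
  destruct (extremal_shape_calH m (l1 * k1 + l2 * k2)%C f) as [Hf Hf'].
  - apply rational_plus; apply rational_mult; auto using rational_const.
  - now apply extremal_shape_combination.
  - intros z Hz. eapply Rle_trans; [apply Cmod_triangle |].
    rewrite !Cmod_mult, !Cmod_R, !Rabs_pos_eq, !Cmod_kernel by assumption. lra.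
  - exists f. split; [exact Hf | split; [exact Hf' |]].
    unfold f. rewrite E1, E2. transitivity ((l1 - l2)%R * e)%C; [rewrite RtoC_minus; ring |].
    rewrite Ew at 1. f_equal. f_equal. unfold l1, l2. field.
Qed.

Theorem theorem5 (z0 : C) (hz0 : unit_disk z0) :
  (forall w : C, V 1 z0 w <-> w = RtoC 1) /\
  (forall p : nat, (2 <= p)%nat -> forall w : C, V p z0 w <-> closure unit_disk w).
Proof.
  split.
  - intros w. split.
    + intros [f [[Hf [H0 Hb]] [_ <-]]].
      now apply harmonic_bounded_center.
    + intros ->. exists (fun _ => RtoC 1). split; [split; [split |] |].
      * apply (rational_class_C true), rational_const.
      * intros z Hz. now apply (laplacian_analytic _ (fun _ => RtoC 1) z (rational_const _ _)).
      * split; [reflexivity |]. intros z _. rewrite Cmod_1. lra.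
      (* [calH (1 - 1)] reduces to [False], the convention that the class of index 0 is empty. *)
      * now split.
  - intros p Hp w. destruct p as [| [| m]]; [lia | lia |]. rewrite closure_unit_disk. split.
    + intros [f [[_ [_ Hb]] [_ <-]]]. now apply Hb.
    + now apply V_onto.
Qed.
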